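(* Let $\mathcal A \subset \mathbb{R}$ be a finite, non-empty set such that $|\mathcal A+ \mathcal A|/|\mathcal A| = K$ for some $K \geq 1$. Then \[ K^{-3}|\mathcal A|^{10} \ll \mathfrak{C}_3(\mathcal A) \ll K^6 |\mathcal A|^{10} (\log (2|\mathcal A|))^3, \] where the implied constants are absolute.
   Context: $\mathcal A+\mathcal A=\{a+b: a,b\in\mathcal A\}$. For a finite set $\mathcal A\subset\mathbb{R}$, $\mathfrak{C}_3(\mathcal A)$ denotes the number of pairs $(A,B)$ of $3\times 3$ matrices, all of whose entries lie in $\mathcal A$, such that $AB=BA$. *)

(* Defs.v *)
From HB Require Import structures.
From mathcomp Require Import all_boot all_order all_algebra.
From mathcomp Require Import reals exp.
Set Implicit Arguments. Unset Strict Implicit. Unset Printing Implicit Defensive.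
Import Order.TTheory GRing.Theory Num.Theory.
Local Open Scope ring_scope.

(* A finite set A ⊂ R is represented by a duplicate-free list A : seq R. *)

Definition sumset_card (R : realType) (A : seq R) : nat :=
  size (undup [seq a + b | a <- A, b <- A]).

(* The 3x3 real matrix whose (i,j) entry is the (M i j)-th element of A.
   For uniq A this is a bijection between 'M['I_(size A)]_3 and the
   3x3 matrices with all entries in A. *)
Definition mx_of_idx (R : realType) (A : seq R) (M : 'M['I_(size A)]_3)
  : 'M[R]_3 := map_mx (fun i : 'I_(size A) => nth 0 A i) M.

Definition C3 (R : realType) (A : seq R) : nat :=
  #|[set p : 'M['I_(size A)]_3 * 'M['I_(size A)]_3 |
       (mx_of_idx p.1 *m mx_of_idx p.2 == mx_of_idx p.2 *m mx_of_idx p.1)]|.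

(* Main.v *)
Require Import Defs.
From HB Require Import structures.
From mathcomp Require Import all_boot all_order all_algebra.
From mathcomp Require Import reals exp.
From mathcomp Require Import zify ring lra.
Set Implicit Arguments. Unset Strict Implicit. Unset Printing Implicit Defensive.
Import Order.TTheory GRing.Theory Num.Theory.
Local Open Scope ring_scope.

(** Lower bound: [A] commutes with [B = A - lambda I], and two applications of
    Cauchy-Schwarz give at least [n^4 / K^2] triples of pairs
    [(a_ii, b_ii)] with a common difference.

    Upper bound: [A B = B A] forces the three determinants
    [a_ij b_ji - a_ji b_ij], over [ij = 12, 23, 31], to have a common value [t],
    and is linear in the differences [(a_ii - a_jj, b_ii - b_jj)].  If [t != 0],
    these differences are determined by the off-diagonal entries.  If [t = 0],
    the off-diagonal entries have at most [E^3] choices, where [E] is the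
    multiplicative energy, and they leave [n^4] choices for the diagonals, unless
    two of the three quadruples vanish.  As every value of the determinant is
    taken at most [E] times, there are at most [5 n^4 E^3] commuting pairs.
    Finally [E << |A+A|^2 log |A|] by Solymosi's argument: the vector sums of
    points of the grid on consecutive rich lines through the origin are distinct. *)

(** * Collisions and Cauchy-Schwarz *)

Lemma card_set_sum (X : finType) (P : pred X) :
  #|[set x | P x]| = (\sum_x P x)%N.
Proof.
rewrite -sum1_card big_mkcond; apply: eq_bigr => x _.
by rewrite inE; case: (P x).
Qed.

Lemma card_set_pair (X Y : finType) (P : X -> Y -> bool) :
  #|[set p : X * Y | P p.1 p.2]| = (\sum_x #|[set y | P x y]|)%N.
Proof.
rewrite card_set_sum; under [RHS]eq_bigr do rewrite card_set_sum.
by rewrite pair_bigA.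
Qed.

(** Double counting: after the sums are exchanged, each [x] with [P x] contributes [F (h x)] at the
    single entry [u = h x] of [W], or nothing if [W] misses [h x]. *)
Lemma sum_fibers_cond (X : finType) (V : eqType) (P : pred X) (h : X -> V)
    (F : V -> nat) (W : seq V) : uniq W ->
  (\sum_(u <- W) #|[set x | P x && (h x == u)]| * F u =
     \sum_(x | P x && (h x \in W)) F (h x))%N.
Proof.
move=> uW; under eq_bigr do rewrite card_set_sum big_distrl /=.
rewrite exchange_big /= [RHS]big_mkcond /=; apply: eq_bigr => x _.
case: (P x) => /=; last by rewrite big1.
case: ifP => hx; last first.
  by rewrite big1_seq // => u /andP[_ uin]; case: eqP => // e; rewrite e uin in hx.
rewrite (bigD1_seq (h x)) //= eqxx mul1n big1 ?addn0 // => u.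
by rewrite eq_sym => /negPf->.
Qed.

Lemma sum_fibers (X : finType) (V : eqType) (h : X -> V) (F : V -> nat)
    (W : seq V) : uniq W ->
  (\sum_(u <- W) #|[set x | h x == u]| * F u = \sum_(x | h x \in W) F (h x))%N.
Proof. exact: (sum_fibers_cond predT h F). Qed.

Lemma card_collisions (X : finType) (V : eqType) (h : X -> V) (W : seq V) :
  uniq W -> (forall x, h x \in W) ->
  #|[set p : X * X | h p.1 == h p.2]| =
    (\sum_(u <- W) #|[set x | h x == u]| ^ 2)%N.
Proof.
move=> uW hW; rewrite (card_set_pair (fun x y => h x == h y)).
under eq_bigr => x _ do under eq_finset => y do rewrite eq_sym.
under [RHS]eq_bigr do rewrite -mulnn.
rewrite (sum_fibers h (fun u => #|[set x | h x == u]|)) //.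
by apply: eq_bigl => x; rewrite hW.
Qed.

(** With [g u] the size of the fibre over [u], the left side is the sum of [g(u) g(u + t)], and
    [2xy <= x^2 + y^2] bounds it by the sum of [g(u)^2]. *)
Lemma card_shifted_collisions_le (X : finType) (V : zmodType) (h : X -> V)
    (t : V) :
  (#|[set p : X * X | (h p.1 == h p.2 + t)%R]| <=
     #|[set p : X * X | h p.1 == h p.2]|)%N.
Proof.
pose g u := #|[set x | h x == u]|; pose W := undup (codom h).
have uW : uniq W by exact: undup_uniq.
have hW x : h x \in W by rewrite mem_undup codom_f.
rewrite (card_collisions uW hW) -/g.
have -> : #|[set p : X * X | h p.1 == h p.2 + t]| =
    (\sum_(u <- W) g u * g (u + t)%R)%N.
  rewrite (sum_fibers h (fun u => g (u + t))) //.
  rewrite card_set_sum -(pair_bigA _ (fun x y => (h x == h y + t) : nat)) /=.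
  rewrite exchange_big /=; apply: eq_big => [y|y _]; first by rewrite hW.
  by rewrite /g card_set_sum.
rewrite -(leq_pmul2l (isT : 0 < 2)%N) [leqRHS]mul2n -addnn.
(* The translate of [W] may leave the image of [h], but only values taken by [h] contribute. *)
have le_shift : (\sum_(u <- W) g (u + t)%R ^ 2 <= \sum_(u <- W) g u ^ 2)%N.
  have uWt : uniq [seq u + t | u <- W] by rewrite map_inj_uniq //; exact: addIr.
  rewrite -(big_map (fun u => u + t) predT (fun w => g w ^ 2)%N) /=.
  under eq_bigr do rewrite -mulnn.
  rewrite (sum_fibers h g) // [leqLHS]big_mkcond /=.
  under [leqRHS]eq_bigr do rewrite -mulnn.
  rewrite (sum_fibers h g) // [leqRHS]big_mkcond /=; apply: leq_sum => x _.
  by rewrite hW; case: ifP.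
apply: leq_trans (leq_add (leqnn _) le_shift).
rewrite -big_split /= big_distrr /=; apply: leq_sum => u _.
by rewrite (nat_Cauchy (g u) (g (u + t))).
Qed.

Lemma sum_sqr_le (I : Type) (s : seq I) (a : I -> nat) :
  ((\sum_(i <- s) a i) ^ 2 <= size s * \sum_(i <- s) a i ^ 2)%N.
Proof.
elim: s => [|i s ih]; first by rewrite !big_nil.
rewrite !big_cons /=.
have cross : (2 * (a i * \sum_(j <- s) a j) <=
    size s * a i ^ 2 + \sum_(j <- s) a j ^ 2)%N.
  elim: (s) => [|j r ihr]; first by rewrite !big_nil muln0.
  rewrite !big_cons /= !mulnDr [((size r).+1 * _)%N]mulSn addnACA.
  by apply: leq_add => //; rewrite (nat_Cauchy (a i) (a j)).
rewrite sqrnD [((size s).+1 * _)%N]mulSn mulnDr -addnA -addnA leq_add2l.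
by rewrite [leqLHS]addnC [leqRHS]addnA leq_add // addnC.
Qed.

(* Cauchy-Schwarz twice: once over the sums, giving many additive quadruples,
   and once over the pairs, giving many triples with a common difference. *)
Lemma card_equal_differences_ge (T : finType) (V : zmodType) (f : T -> V)
    (S : seq V) : uniq S -> (forall x y, f x + f y \in S) ->
  (#|T| ^ 6 <= size S ^ 2 *
     #|[set e : (T * T) * ((T * T) * (T * T)) |
        ((f e.1.1 - f e.1.2 == f e.2.1.1 - f e.2.1.2) &&
        (f e.1.1 - f e.1.2 == f e.2.2.1 - f e.2.2.2))%R]|)%N.
Proof.
move=> uS fS; pose h (p : T * T) := f p.1 - f p.2.
pose s (p : T * T) := f p.1 + f p.2.
pose g u := #|[set p | h p == u]|.
set N := #|[set e | _]|.
have NE : N = (\sum_p g (h p) ^ 2)%N.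
  rewrite /N (card_set_pair (fun p (q : (T * T) * (T * T)) =>
    (h p == h q.1) && (h p == h q.2))); apply: eq_bigr => p _.
  have -> : [set y : (T * T) * (T * T) | (h p == h y.1) && (h p == h y.2)] =
      setX [set q | h q == h p] [set q | h q == h p].
    by apply/setP => y; rewrite !inE ![h p == _]eq_sym.
  by rewrite cardsX -mulnn.
pose E := (\sum_p g (h p))%N.
have EN : (E ^ 2 <= #|T| ^ 2 * N)%N.
  apply: leq_trans (sum_sqr_le _ _) _.
  rewrite -NE -sum1_size (eq_bigl [in predT]) // sum1_card card_prod mulnn.
  exact: leqnn.
have EE : E = #|[set q : (T * T) * (T * T) | s q.1 == s q.2]|.
  have -> : E = #|[set q : (T * T) * (T * T) | h q.1 == h q.2]|.
    rewrite (card_set_pair (fun x y => h x == h y)); apply: eq_bigr => p _.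
    by rewrite /g; apply: eq_card => q; rewrite !inE eq_sym.
  (* Swapping two entries turns [x - y = z - t] into [x + t = z + y]. *)
  pose w (q : (T * T) * (T * T)) := ((q.1.1, q.2.2), (q.2.1, q.1.2)).
  have wK : involutive w by case=> [[? ?] [? ?]].
  rewrite -(card_imset _ (inv_inj wK)); apply: eq_card => q.
  rewrite !inE -{1}(wK q) mem_imset; last exact: inv_inj.
  rewrite inE /w /h /s /=; apply/eqP/eqP => e.
    by apply/eqP; rewrite -subr_eq addrAC e subrK.
  by apply/eqP; rewrite subr_eq addrAC -e addrK.
have SE : (#|T| ^ 4 <= size S * E)%N.
  rewrite EE (@card_collisions _ _ s S) //; last by move=> p; apply: fS.
  apply: leq_trans (sum_sqr_le _ _).
  under eq_bigr do rewrite -[X in #|pred_of_set X|]/([set x | s x == _]) -[#|_|]muln1.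
  rewrite (sum_fibers s (fun=> 1%N)) //.
  rewrite (eq_bigl predT) => [|p]; last by rewrite fS.
  by rewrite sum1_card card_prod mulnn -expnM.
have [->|nz] := eqVneq #|T| 0%N; first by rewrite exp0n.
have : (#|T| ^ 2 * #|T| ^ 6 <= #|T| ^ 2 * (size S ^ 2 * N))%N.
  rewrite -expnD mulnCA.
  apply: leq_trans (leq_mul (leqnn _) EN).
  by rewrite -expnMn (expnM _ 4 2) leq_exp2r.
by rewrite leq_pmul2l // expn_gt0 lt0n nz.
Qed.

(** * Solymosi's bound on the multiplicative energy *)

(** [u] and [v] are kept separate so that each axis can be reflected on its own, which brings every
    open quadrant to the first. *)
Definition ray (R : realFieldType) (T : finType) (u v : T -> R) (l : R) :
    {set T * T} :=
  [set p | [&& 0 < u p.1, 0 < v p.2 & v p.2 == l * u p.1]].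

(** The line of slope [l] bounds this cone from below: its points lie above that line. *)
Definition cone_below (R : realFieldType) (l : R) : pred (R * R) :=
  fun z => (0 < z.1) && (l * z.1 < z.2).

Lemma card_ray_le (R : realFieldType) (T : finType) (u v : T -> R) (l : R) :
  injective v -> (#|ray u v l| <= #|T|)%N.
Proof.
move=> v_inj; apply: (@leq_card_in _ _ (fun p : T * T => p.1)).
move=> [x y] [x' y']; rewrite !inE /= => /and3P[_ _ /eqP e] /and3P[_ _ /eqP e'] xx.
by congr pair => //; apply: v_inj; rewrite e e' xx.
Qed.

Lemma card_sums_ge (R : realFieldType) (T : finType) (u : T -> R) (S : seq R) :
  injective u -> (forall x y, u x + u y \in S) -> (#|T| <= size S)%N.
Proof.
move=> u_inj uS; have [->//|/card_gt0P[x0 _]] := posnP #|T|.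
rewrite cardE -(size_map (fun x => u x0 + u x)); apply: uniq_leq_size.
  by rewrite map_inj_uniq ?enum_uniq // => x y /addrI/u_inj.
by move=> _ /mapP[x _ ->]; apply: uS.
Qed.

(** Points on two distinct lines through the origin are recovered from their vector sum, the
    directions [(1, l)] and [(1, m)] being independent; positivity puts the sum strictly between the
    lines. *)
Lemma card_rays_mul_le (R : realFieldType) (T : finType) (u v : T -> R)
    (SU SV : seq R) (l m : R) : injective u -> injective v ->
  (forall x y, u x + u y \in SU) -> (forall x y, v x + v y \in SV) -> l < m ->
  (#|ray u v l| * #|ray u v m| <=
     count (fun z => [&& 0 < z.1, l * z.1 < z.2 & z.2 < m * z.1]%R)
       [seq (x, y) | x <- SU, y <- SV])%N.
Proof.
move=> u_inj v_inj hU hV lm.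
pose plus (q : (T * T) * (T * T)) := (u q.1.1 + u q.2.1, v q.1.2 + v q.2.2).
rewrite -cardsX cardE -(size_map plus) -size_filter; apply: uniq_leq_size.
  rewrite map_inj_in_uniq ?enum_uniq // => -[[x y] [x' y']] [[z w] [z' w']].
  rewrite !mem_enum !inE /= /plus /=.
  case/andP=> /and3P[_ _ /eqP e1] /and3P[_ _ /eqP e2].
  case/andP=> /and3P[_ _ /eqP e3] /and3P[_ _ /eqP e4].
  case=> eu ev.
  have exz' : u x' = u z'.
    apply: (mulfI (lt0r_neq0 (_ : 0 < m - l))); first by rewrite subr_gt0.
    have ex : u x = u z + u z' - u x' by rewrite -eu addrK.
    by move: ev; rewrite e1 e2 e3 e4 ex; lra.
  have exz : u x = u z by move: eu; rewrite exz' => /addIr.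
  have eyw : v y = v w by rewrite e1 e3 exz.
  have eyw' : v y' = v w' by rewrite e2 e4 exz'.
  by rewrite (u_inj _ _ exz) (u_inj _ _ exz') (v_inj _ _ eyw) (v_inj _ _ eyw').
move=> _ /mapP[[[x y] [x' y']] + ->].
rewrite mem_enum !inE /=.
case/andP=> /and3P[u0 v0 /eqP e1] /and3P[u0' v0' /eqP e2].
rewrite mem_filter /plus /= allpairs_f // andbT e1 e2.
have h1 : 0 < (m - l) * u x by rewrite mulr_gt0 // subr_gt0.
have h2 : 0 < (m - l) * u x' by rewrite mulr_gt0 // subr_gt0.
by apply/and3P; split; lra.
Qed.

(** Induction along increasing slopes: the sums from the rays of slopes [l] and [m] lie in the open
    cone between them, which is disjoint from the cone above [m] given to the induction
    hypothesis. *)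
Lemma size_path_rays_le (R : realFieldType) (T : finType) (u v : T -> R)
    (SU SV : seq R) (s : nat) (L : seq R) (l : R) :
  injective u -> injective v ->
  (forall x y, u x + u y \in SU) -> (forall x y, v x + v y \in SV) ->
  path <%R l L -> (forall m, m \in l :: L -> (s <= #|ray u v m|)%N) ->
  (size L * s ^ 2 <= count (cone_below l) [seq (x, y) | x <- SU, y <- SV])%N.
Proof.
move=> u_inj v_inj hU hV; set P := [seq (x, y) | x <- SU, y <- SV].
elim: L l => [//|m L ih] l /= /andP[lm pL] rich.
have {}ih := ih m pL (fun k km => rich k (@mem_behead _ (l :: m :: L) k km)).
have step := card_rays_mul_le u_inj v_inj hU hV lm.
have s2 : (s ^ 2 <= #|ray u v l| * #|ray u v m|)%N.
  by rewrite -mulnn leq_mul // rich // !inE eqxx ?orbT.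
rewrite mulSn; apply: leq_trans (leq_add (leq_trans s2 step) ih) _.
rewrite -/P -count_predUI; set c0 := count (predI _ _) _.
have -> : c0 = 0%N.
  rewrite /c0 (@eq_count _ _ pred0) ?count_pred0 // => z /=.
  by apply/negP => /andP[/and3P[_ _ h1] /andP[_ h2]]; lra.
rewrite addn0; apply: sub_count => z /= /orP[/and3P[h1 h2 _]|/andP[h1 h2]].
  by rewrite /cone_below h1.
rewrite /cone_below h1 /=; have : 0 < (m - l) * z.1 by rewrite mulr_gt0 // subr_gt0.
by lra.
Qed.

Lemma size_rich_slopes_le (R : realFieldType) (T : finType) (u v : T -> R)
    (SU SV : seq R) (s : nat) (L : seq R) :
  injective u -> injective v ->
  (forall x y, u x + u y \in SU) -> (forall x y, v x + v y \in SV) ->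
  uniq L -> (forall m, m \in L -> (s <= #|ray u v m|)%N) ->
  (size L * s ^ 2 <= 2 * (size SU * size SV))%N.
Proof.
move=> u_inj v_inj hU hV uL rich.
rewrite -(size_sort <=%R L); have: sorted <%R (sort <=%R L) by rewrite sort_lt_sorted.
have {}rich m : m \in sort <=%R L -> (s <= #|ray u v m|)%N.
  by rewrite mem_sort; apply: rich.
case: (sort _ _) rich => [//|l L' rich pL]; rewrite [size _]/= mulSn mul2n -addnn.
(* There is one consecutive pair fewer than slopes; the leftover [s^2] is at most [|SU| |SV|]
   because [s <= |T|]. Hence the factor 2. *)
apply: leq_add.
  have le_s : (s <= #|T|)%N.
    by apply: leq_trans (card_ray_le u l v_inj); apply: rich; rewrite mem_head.
  by rewrite -mulnn leq_mul // (leq_trans le_s) //;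
    [apply: (card_sums_ge u_inj hU) | apply: (card_sums_ge v_inj hV)].
apply: leq_trans (size_path_rays_le u_inj v_inj hU hV pL rich) _.
by rewrite -(size_allpairs pair) count_size.
Qed.

(** * Second moments and harmonic numbers *)

Definition harmonic_sum (R : realFieldType) (n : nat) : R :=
  \sum_(i < n) i.+1%:R^-1.

(** Layer-cake summation: [k^2] is the sum of [2i + 1] over [i < k], and at most [M / (i + 1)^2] of
    the [a j] exceed [i], so level [i] contributes at most [2M / (i + 1)]. *)
Lemma sum_sqr_le_harmonic (R : realFieldType) (I : Type) (W : seq I)
    (a : I -> nat) (n M : nat) : (forall i, (a i <= n)%N) ->
  (forall s, (count (fun i => s <= a i) W * s ^ 2 <= M)%N) ->
  (\sum_(i <- W) a i ^ 2)%N%:R <= 2 * M%:R * harmonic_sum R n.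
Proof.
move=> an rich.
have sqE k : (k <= n)%N -> (k ^ 2 = \sum_(i < n) (i < k) * (i.*2.+1))%N.
  move=> kn; rewrite -(big_mkord predT (fun i => (i < k) * i.*2.+1)%N) /=.
  rewrite (big_cat_nat (leq0n k) kn) /= [X in (_ + X)%N]big_nat_cond.
  rewrite [X in (_ + X)%N]big1 ?addn0; last first.
    by move=> i /andP[/andP[ki _] _]; rewrite ltnNge ki.
  rewrite big_mkord (eq_bigr (fun i : 'I_k => i.*2.+1)%N); last first.
    by move=> i _; rewrite ltn_ord mul1n.
  elim: k {kn} => [|k ih]; first by rewrite big_ord0.
  by rewrite big_ord_recr /= -ih; lia.
under eq_bigr do rewrite (sqE _ (an _)).
rewrite exchange_big /= natr_sum /harmonic_sum mulr_sumr; apply: ler_sum => i _.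
have cE : (\sum_(j <- W) (i < a j) = count (fun j => i < a j) W)%N.
  by rewrite -sum1_count [RHS]big_mkcond /=; apply: eq_bigr => j _; case: ltnP.
rewrite -big_distrl /= cE.
rewrite ler_pdivlMr ?ltr0n // -!natrM ler_nat.
by have := rich i.+1; nia.
Qed.

Lemma harmonic_sum_ge1 (R : realFieldType) (n : nat) :
  (0 < n)%N -> 1 <= harmonic_sum R n.
Proof.
case: n => // n _; rewrite /harmonic_sum big_ord_recl invr1 lerDl.
by apply: sumr_ge0 => i _; rewrite invr_ge0 ler0n.
Qed.

Lemma harmonic_sum_le_ln (R : realType) (n : nat) :
  (0 < n)%N -> harmonic_sum R n <= (ln 2)^-1 * ln (2 * n%:R).
Proof.
case: n => // n _.
have H : harmonic_sum R n.+1 <= 1 + ln n.+1%:R.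
  elim: n => [|n ih]; first by rewrite /harmonic_sum big_ord1 invr1 ln1 addr0.
  rewrite /harmonic_sum big_ord_recr /= -/(harmonic_sum R n.+1).
  have p1 : (0 : R) < n.+1%:R by rewrite ltr0n.
  have p2 : (0 : R) < n.+2%:R by rewrite ltr0n.
  have := @le_ln1Dx R (- n.+2%:R^-1).
  have -> : 1 + - n.+2%:R^-1 = n.+1%:R / n.+2%:R :> R.
    by rewrite -{1}(divff (lt0r_neq0 p2)) -{2}[n.+2%:R^-1]mul1r -mulrBl -natr1 addrK.
  rewrite lnM ?lnV ?posrE ?invr_gt0 // ltrN2 invf_lt1 ?ltr1n // => /(_ isT).
  move: (ln n.+1%:R) (ln n.+2%:R) (n.+2%:R^-1) (harmonic_sum R n.+1) ih => a b c d.
  by lra.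
(* Since [0 < ln 2 <= 1], one has [1 + ln k <= (ln 2 + ln k) / ln 2] for [k >= 1]. *)
apply: le_trans H _; rewrite lnM ?posrE ?ltr0n //.
have l2 : 0 < ln 2 :> R by rewrite ln_gt0 // ltr1n.
have l21 : ln 2 <= 1 :> R.
  by have := @le_ln1Dx R 1; rewrite (_ : 1 + 1 = 2) // => -> //; lra.
rewrite mulrDr mulVf ?lt0r_neq0 // lerD2l ler_peMl ?ln_ge0 ?ler1n //.
by rewrite invf_ge1.
Qed.

Lemma sum_rays_sqr_le (R : realFieldType) (T : finType) (u v : T -> R)
    (SU SV W : seq R) : injective u -> injective v ->
  (forall x y, u x + u y \in SU) -> (forall x y, v x + v y \in SV) -> uniq W ->
  (\sum_(l <- W) #|ray u v l| ^ 2)%N%:R <=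
    4 * (size SU)%:R * (size SV)%:R * harmonic_sum R #|T|.
Proof.
move=> u_inj v_inj hU hV uW.
have -> : 4 * (size SU)%:R * (size SV)%:R =
    2 * (2 * (size SU * size SV))%N%:R :> R by rewrite !natrM; ring.
apply: sum_sqr_le_harmonic => [l|s]; first exact: card_ray_le.
rewrite -size_filter; apply: (size_rich_slopes_le u_inj v_inj hU hV).
  by rewrite filter_uniq.
by move=> m; rewrite mem_filter => /andP[].
Qed.

(** * Multiplicative energy *)

Definition mul_energy (R : realFieldType) (T : finType) (f : T -> R) : nat :=
  #|[set q : (T * T) * (T * T) | f q.1.1 * f q.1.2 == f q.2.1 * f q.2.2]|.

Lemma card_zero_products_le (R : realFieldType) (T : finType) (f : T -> R) :
  injective f -> (#|[set p : T * T | (f p.1 * f p.2 == 0)%R]| <= 2 * #|T|)%N.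
Proof.
move=> f_inj; rewrite mul2n -addnn -card_sum.
(* One factor is the unique zero of [f]; the image records the other factor and the side of the
   zero. *)
apply: (@leq_card_in _ _ (fun p : T * T =>
  if f p.1 == 0 then inl p.2 else inr p.1 : T + T)).
move=> [x y] [x' y']; rewrite !inE /= !mulf_eq0.
have [x0 _|_ /= /eqP y0] := eqVneq (f x) 0;
  have [x0' _|_ /= /eqP y0'] := eqVneq (f x') 0 => // -[->].
  by rewrite (f_inj x x') // x0 x0'.
by rewrite (f_inj y y') // y0 y0'.
Qed.

Definition slope (R : realFieldType) (T : finType) (f : T -> R) (p : T * T) : R :=
  f p.2 / f p.1.

Definition off_axes (R : realFieldType) (T : finType) (f : T -> R) : pred (T * T) :=
  fun p => (f p.1 != 0) && (f p.2 != 0).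

(** Each point off the axes lies in one open quadrant, and reflecting it into the first multiplies
    its slope by both signs. *)
Lemma card_slope_le_rays (R : realFieldType) (T : finType) (f : T -> R) (l : R) :
  (#|[set p | off_axes f p && (slope f p == l)]| <=
    \sum_(s : bool * bool)
      #|ray (fun x => (-1) ^+ s.1 * f x)%R (fun x => (-1) ^+ s.2 * f x)%R
            ((-1) ^+ s.1 * (-1) ^+ s.2 * l)%R|)%N.
Proof.
rewrite card_set_sum; under [leqRHS]eq_bigr do rewrite card_set_sum.
rewrite exchange_big /=; apply: leq_sum => -[x y] _.
case: andP => //= -[/andP[/= x0 y0] /eqP le].
rewrite (bigD1 (f x < 0, f y < 0)) //=.
have sg (z : R) : z != 0 -> 0 < (-1) ^+ (z < 0)%R * z.
  move=> z0; rewrite mulr_sign; case: (ltrP z 0) => z1; first by rewrite oppr_gt0.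
  by rewrite lt_neqAle eq_sym z0.
have e : (-1) ^+ (f y < 0)%R * f y =
    (-1) ^+ (f x < 0)%R * (-1) ^+ (f y < 0)%R * l * ((-1) ^+ (f x < 0)%R * f x).
  rewrite -le /slope /=.
  by case: (f x < 0); case: (f y < 0); rewrite ?expr0 ?expr1; field.
by rewrite !sg //= e eqxx.
Qed.

(** In [64 = 4 * 4 * 4], one factor comes from Cauchy-Schwarz over the quadrants, one from summing
    over them, and one from [sum_rays_sqr_le]. *)
Lemma sum_slopes_sqr_le (R : realFieldType) (T : finType) (f : T -> R)
    (S W : seq R) :
  injective f -> (forall x y, f x + f y \in S) -> uniq W ->
  (\sum_(l <- W) #|[set p | off_axes f p && (slope f p == l)]| ^ 2)%N%:R <=
    64 * (size S)%:R ^+ 2 * harmonic_sum R #|T|.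
Proof.
move=> f_inj fS uW.
pose r (s : bool * bool) l := #|ray (fun x => (-1) ^+ s.1 * f x)
  (fun x => (-1) ^+ s.2 * f x) ((-1) ^+ s.1 * (-1) ^+ s.2 * l)|.
have sgK (b : bool) : injective ( *%R ((-1) ^+ b : R)).
  by apply: mulfI; rewrite signr_eq0.
have le1 : (\sum_(l <- W) #|[set p | off_axes f p && (slope f p == l)]| ^ 2 <=
    4 * \sum_(s : bool * bool) \sum_(l <- W) r s l ^ 2)%N.
  rewrite exchange_big big_distrr /=; apply: leq_sum => l _.
  apply: (@leq_trans ((\sum_(s : bool * bool) r s l) ^ 2)).
    by rewrite leq_exp2r // card_slope_le_rays.
  apply: leq_trans (sum_sqr_le _ _) _.
  by rewrite -sum1_size (eq_bigl [in predT]) // sum1_card card_prod card_bool.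
have le2 s : (\sum_(l <- W) r s l ^ 2)%N%:R <=
    4 * (size S)%:R ^+ 2 * harmonic_sum R #|T|.
  pose c : R := (-1) ^+ s.1 * (-1) ^+ s.2.
  have := @sum_rays_sqr_le R T (fun x => (-1) ^+ s.1 * f x)
    (fun x => (-1) ^+ s.2 * f x) [seq (-1) ^+ s.1 * z | z <- S]
    [seq (-1) ^+ s.2 * z | z <- S] [seq c * l | l <- W].
  rewrite big_map !size_map expr2 mulrA; apply.
  - by move=> x y /sgK/f_inj.
  - by move=> x y /sgK/f_inj.
  - by move=> x y; rewrite -mulrDr; apply: map_f.
  - by move=> x y; rewrite -mulrDr; apply: map_f.
  - by rewrite map_inj_uniq //; apply: mulfI; rewrite mulf_neq0 // signr_eq0.
apply: le_trans (_ : _ <= (4 * \sum_(s : bool * bool) \sum_(l <- W) r s l ^ 2)%N%:R) _.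
  by rewrite ler_nat.
rewrite natrM natr_sum.
have := ler_sum (index_enum _) (fun s (_ : true) => le2 s).
rewrite sumr_const card_prod card_bool -[_ *+ (2 * 2)]mulr_natl => le3.
by rewrite [64 * _](_ : _ = 4 * ((2 * 2)%:R * (4 * (size S)%:R ^+ 2))); [lra|ring].
Qed.

(* A nondegenerate solution of [a b = c d] is a pair of points [(a, c)], [(d, b)]
   of the grid with the same slope. *)
Lemma mul_energy_le_slopes (R : realFieldType) (T : finType) (f : T -> R) :
  injective f -> exists2 W : seq R, uniq W &
  (mul_energy f <= 4 * #|T| ^ 2 +
     \sum_(l <- W) #|[set p | off_axes f p && (slope f p == l)]| ^ 2)%N.
Proof.
move=> f_inj; pose W := undup [seq slope f p | p <- enum {: T * T}].
exists W; first exact: undup_uniq.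
pose N l := #|[set p | off_axes f p && (slope f p == l)]|.
under eq_bigr do rewrite -mulnn.
rewrite (sum_fibers_cond (off_axes f) (slope f) N) ?undup_uniq //.
pose Z := [set p : T * T | f p.1 * f p.2 == 0].
pose w (q : (T * T) * (T * T)) := ((q.1.1, q.2.1), (q.2.2, q.1.2)).
have w_inj : injective w by move=> [[? ?] [? ?]] [[? ?] [? ?]] [-> -> -> ->].
pose C := [set q : (T * T) * (T * T) |
  off_axes f q.1 && (off_axes f q.2 && (slope f q.2 == slope f q.1))].
(* A solution whose product is zero has both its pairs in [Z]; any other is sent by [w] to two
   points of equal slope. *)
have sub : [set q : (T * T) * (T * T) | f q.1.1 * f q.1.2 == f q.2.1 * f q.2.2]
    \subset setX Z Z :|: w @^-1: C.
  apply/subsetP => -[[x y] [z t]]; rewrite !inE /=.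
  rewrite /off_axes /slope /= => /eqP e; rewrite -e andbb.
  have [//|nz] := eqVneq (f x * f y) 0; rewrite /=.
  have := nz; rewrite {1}e; move: nz; rewrite !mulf_eq0 !negb_or.
  move=> /andP[x0 y0] /andP[z0 t0]; rewrite x0 y0 z0 t0 /=.
  by rewrite eqr_div // mulrC e.
apply: leq_trans (subset_leq_card sub) _.
apply: leq_trans (leq_card_setU _ _) _; apply: leq_add.
  rewrite cardsX (_ : 4 * #|T| ^ 2 = (2 * #|T|) * (2 * #|T|))%N; last by rewrite mulnACA mulnn.
  by rewrite leq_mul // card_zero_products_le.
rewrite card_preimset // (card_set_pair (fun p q =>
  off_axes f p && (off_axes f q && (slope f q == slope f p)))).
rewrite [leqRHS]big_mkcond /=; apply: leq_sum => p _.
rewrite mem_undup map_f ?mem_enum // andbT.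
case: (off_axes f p) => //=.
by rewrite leqn0 cards_eq0; apply/eqP/setP => q; rewrite !inE.
Qed.

(** Here [68 = 64 + 4]: the [4 |T|^2] degenerate solutions are absorbed because [|T| <= |S|] and the
    harmonic sum is at least 1. *)
Lemma mul_energy_le (R : realFieldType) (T : finType) (f : T -> R) (S : seq R) :
  injective f -> (forall x y, f x + f y \in S) -> (0 < #|T|)%N ->
  (mul_energy f)%:R <= 68 * (size S)%:R ^+ 2 * harmonic_sum R #|T|.
Proof.
move=> f_inj fS T0; have [W uW le] := mul_energy_le_slopes f_inj.
apply: le_trans (_ : _ <= _%:R) _; first by rewrite ler_nat; exact: le.
rewrite natrD natrM natrX.
have := sum_slopes_sqr_le f_inj fS uW.
have hT : #|T|%:R <= (size S)%:R :> R by rewrite ler_nat (card_sums_ge f_inj fS).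
have hT2 : (#|T|%:R : R) ^+ 2 <= (size S)%:R ^+ 2.
  by rewrite lerXn2r // nnegrE ler0n.
have h1 := harmonic_sum_ge1 R T0.
have : (size S)%:R ^+ 2 <= (size S)%:R ^+ 2 * harmonic_sum R #|T|.
  by rewrite ler_peMr // sqr_ge0.
by lra.
Qed.

Lemma mul_energy_ge (R : realFieldType) (T : finType) (f : T -> R) :
  (#|T| ^ 2 <= mul_energy f)%N.
Proof.
rewrite -mulnn -card_prod.
have dinj : injective (fun p : T * T => (p, p)) by move=> p q [].
rewrite -(card_imset _ dinj); apply: subset_leq_card.
by apply/subsetP => _ /imsetP[p _ ->]; rewrite inE eqxx.
Qed.

(** * Diagonal entries of a commuting pair *)

(* For [i != j], the entries [a_ij], [a_ji], [b_ij], [b_ji] of two matrices are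
   stored as the quadruple [((a_ij, b_ji), (a_ji, b_ij))], and the diagonal
   entries [a_ii], [b_ii] as the pair [(a_ii, b_ii)]. *)

Definition qdet (R : realFieldType) (T : finType) (f : T -> R)
    (q : (T * T) * (T * T)) : R :=
  f q.1.1 * f q.1.2 - f q.2.1 * f q.2.2.

Definition qzero (R : realFieldType) (T : finType) (f : T -> R)
    (q : (T * T) * (T * T)) : bool :=
  [&& f q.1.1 == 0, f q.1.2 == 0, f q.2.1 == 0 & f q.2.2 == 0].

(** The equations given by the entries [ij] and [ji] of [AB = BA], in the two differences of
    diagonal entries; the determinant of this system is [qdet f q]. *)
Definition link (R : realFieldType) (T : finType) (f : T -> R)
    (q : (T * T) * (T * T)) (c : R * R) (e e' : T * T) : bool :=
  ((f e.1 - f e'.1) * f q.2.2 - (f e.2 - f e'.2) * f q.1.1 == c.1) &&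
  ((f e.1 - f e'.1) * f q.1.2 - (f e.2 - f e'.2) * f q.2.1 == c.2).

Lemma link_sym (R : realFieldType) (T : finType) (f : T -> R) q (c : R * R) e e' :
  link f q c e e' = link f q (- c) e' e.
Proof.
have H (a b a' b' x y z : R) :
    ((a - a') * x - (b - b') * y == z) = ((a' - a) * x - (b' - b) * y == - z).
  by rewrite -[RHS]eqr_opp opprK; congr (_ == _); ring.
by rewrite /link H [X in _ && X]H.
Qed.

Lemma card_line_le (R : realFieldType) (T : finType) (f : T -> R)
    (a b c : R) (e : T * T) : injective f -> (a != 0) || (b != 0) ->
  (#|[set e' : T * T |
      ((f e.1 - f e'.1) * b - (f e.2 - f e'.2) * a == c)%R]| <= #|T|)%N.
Proof.
move=> f_inj /orP[a0|b0].
  apply: (@leq_card_in _ _ (fun e' : T * T => e'.1)) => -[x y] [x' y'].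
  rewrite !inE /= => /eqP <- /eqP + xx; rewrite xx => /eqP.
  rewrite (inj_eq (addrI _)) eqr_opp => /eqP/(mulIf a0)/addrI/oppr_inj/f_inj.
  by move->.
apply: (@leq_card_in _ _ (fun e' : T * T => e'.2)) => -[x y] [x' y'].
rewrite !inE /= => /eqP <- /eqP + yy; rewrite yy => /eqP.
by rewrite (inj_eq (addIr _)) => /eqP/(mulIf b0)/addrI/oppr_inj/f_inj ->.
Qed.

Lemma card_link_le (R : realFieldType) (T : finType) (f : T -> R) q (c : R * R)
    (e : T * T) : injective f -> ~~ qzero f q ->
  (#|[set e' | link f q c e e']| <= #|T|)%N.
Proof.
move=> f_inj nz.
have [h|] := boolP ((f q.1.1 != 0) || (f q.2.2 != 0)).
  apply: leq_trans (card_line_le c.1 e f_inj h); apply: subset_leq_card.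
  by apply/subsetP => e'; rewrite !inE => /andP[].
rewrite negb_or !negbK => /andP[h1 h2].
have h : (f q.2.1 != 0) || (f q.1.2 != 0).
  by move: nz; rewrite /qzero h1 h2 /= andbT negb_and orbC.
apply: leq_trans (card_line_le c.2 e f_inj h); apply: subset_leq_card.
by apply/subsetP => e'; rewrite !inE => /andP[].
Qed.

Lemma card_link_le1 (R : realFieldType) (T : finType) (f : T -> R) q (c : R * R)
    (e : T * T) : injective f -> qdet f q != 0 ->
  (#|[set e' | link f q c e e']| <= 1)%N.
Proof.
move=> f_inj d0; apply/card_le1P => -[x y]; rewrite inE => /andP[/eqP /= h1 /eqP /= h2].
move=> [x' y']; rewrite !inE; apply/idP/eqP => [/andP[/eqP /= h3 /eqP /= h4]|[-> ->]].
  (* Cramer's rule by elimination: the multipliers [f q.2.1] and [f q.1.1] cancel the second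
     unknown. *)
  have ex : f x' = f x.
    apply: (mulfI d0); rewrite /qdet; move: h1; rewrite -h3 => h1.
    have : f q.2.1 * ((f e.1 - f x') * f q.2.2 - (f e.2 - f y') * f q.1.1) =
           f q.2.1 * ((f e.1 - f x) * f q.2.2 - (f e.2 - f y) * f q.1.1).
      by rewrite h1.
    have : f q.1.1 * ((f e.1 - f x') * f q.1.2 - (f e.2 - f y') * f q.2.1) =
           f q.1.1 * ((f e.1 - f x) * f q.1.2 - (f e.2 - f y) * f q.2.1).
      by rewrite h2 h4.
    by lra.
  have ey : f y' = f y.
    apply: (mulfI d0); rewrite /qdet; move: h1; rewrite -h3 => h1.
    have : f q.1.2 * ((f e.1 - f x') * f q.2.2 - (f e.2 - f y') * f q.1.1) =
           f q.1.2 * ((f e.1 - f x) * f q.2.2 - (f e.2 - f y) * f q.1.1).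
      by rewrite h1.
    have : f q.2.2 * ((f e.1 - f x') * f q.1.2 - (f e.2 - f y') * f q.2.1) =
           f q.2.2 * ((f e.1 - f x) * f q.1.2 - (f e.2 - f y) * f q.2.1).
      by rewrite h2 h4.
    by lra.
  by rewrite (f_inj _ _ ex) (f_inj _ _ ey).
by rewrite /link /= h1 h2 !eqxx.
Qed.

(** * Triangles of diagonal pairs *)

Lemma card_star_le (P : finType) (r1 r2 : rel P) (k1 k2 : nat) :
  (forall e, #|[set e' | r1 e e']| <= k1)%N ->
  (forall e, #|[set e' | r2 e e']| <= k2)%N ->
  (#|[set e : P * (P * P) | r1 e.1 e.2.1 && r2 e.1 e.2.2]| <=
     #|P| * (k1 * k2))%N.
Proof.
move=> h1 h2; rewrite (card_set_pair (fun e e' => r1 e e'.1 && r2 e e'.2)).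
rewrite -sum_nat_const; apply: leq_sum => e _.
apply: leq_trans (leq_mul (h1 e) (h2 e)); rewrite -cardsX.
by apply: subset_leq_card; apply/subsetP => e'; rewrite !inE.
Qed.

Definition linked_triangle (R : realFieldType) (T : finType) (f : T -> R)
    (q1 q2 q3 : (T * T) * (T * T)) (c1 c2 c3 : R * R) :
    {set (T * T) * ((T * T) * (T * T))} :=
  [set e | [&& link f q1 c1 e.1 e.2.1, link f q2 c2 e.2.1 e.2.2
             & link f q3 c3 e.2.2 e.1]].

(** Forgetting the edge [q2] leaves a star centred at [e.1], with [|T|^2] choices for the centre and
    [k] for each leaf; [link_sym] orients [q3] outward. *)
Lemma card_linked_triangle_le_star (R : realFieldType) (T : finType) (f : T -> R)
    q1 q2 q3 (c1 c2 c3 : R * R) (k : nat) :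
  (forall c e, #|[set e' | link f q1 c e e']| <= k)%N ->
  (forall c e, #|[set e' | link f q3 c e e']| <= k)%N ->
  (#|linked_triangle f q1 q2 q3 c1 c2 c3| <= #|T| ^ 2 * k ^ 2)%N.
Proof.
move=> h1 h3; rewrite -!mulnn -card_prod.
apply: leq_trans (card_star_le (h1 c1) (h3 (- c3))); apply: subset_leq_card.
apply/subsetP => e; rewrite !inE => /and3P[-> _ /=].
by rewrite link_sym.
Qed.

Lemma card_linked_triangle_rot (R : realFieldType) (T : finType) (f : T -> R)
    q1 q2 q3 (c1 c2 c3 : R * R) :
  #|linked_triangle f q1 q2 q3 c1 c2 c3| =
  #|linked_triangle f q2 q3 q1 c2 c3 c1|.
Proof.
pose w (e : (T * T) * ((T * T) * (T * T))) := (e.2.2, (e.1, e.2.1)).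
have w_inj : injective w by move=> [? [? ?]] [? [? ?]] [-> -> ->].
rewrite -(card_preimset _ w_inj); apply: eq_card => e; rewrite !inE /=.
by rewrite andbC -andbA.
Qed.

(** If the common determinant is nonzero, one vertex fixes the others. If it is zero, either two
    nonzero quadruples form a star with at most [|T|] choices per leaf, or two quadruples vanish and
    the trivial [|T|^6] is used. The cases enter as 0/1 factors, ready to be summed over the
    quadruples. *)
Lemma card_linked_triangle_le (R : realFieldType) (T : finType) (f : T -> R)
    q1 q2 q3 (c1 c2 c3 : R * R) : injective f ->
  qdet f q2 = qdet f q1 -> qdet f q3 = qdet f q1 ->
  (#|linked_triangle f q1 q2 q3 c1 c2 c3| <=
    #|T| ^ 2
    + #|T| ^ 4 * [&& qdet f q1 == 0, qdet f q2 == 0 & qdet f q3 == 0]%R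
    + #|T| ^ 6 * [&& qzero f q1, qzero f q2 & qdet f q3 == 0]%R
    + #|T| ^ 6 * [&& qzero f q2, qzero f q3 & qdet f q1 == 0]%R
    + #|T| ^ 6 * [&& qzero f q3, qzero f q1 & qdet f q2 == 0]%R)%N.
Proof.
move=> f_inj e2 e3; rewrite e2 e3 !andbb.
have [d0|d0] := eqVneq (qdet f q1) 0; last first.
  rewrite !andbF !muln0 !addn0.
  apply: leq_trans (card_linked_triangle_le_star q2 c1 c2 c3 (k := 1) _ _) _.
  - by move=> c e; apply: card_link_le1.
  - by move=> c e; apply: card_link_le1; rewrite ?e3.
  - by rewrite muln1.
rewrite !andbT muln1.
have star q q' q'' (c c' c'' : R * R) : ~~ qzero f q -> ~~ qzero f q'' ->
    (#|linked_triangle f q q' q'' c c' c''| <= #|T| ^ 4)%N.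
  move=> nz nz''; apply: leq_trans (card_linked_triangle_le_star _ _ _ _ _ _) _.
  - by move=> ? ?; apply: card_link_le.
  - by move=> ? ?; apply: card_link_le.
  - by rewrite -expnD.
have triv : (#|linked_triangle f q1 q2 q3 c1 c2 c3| <= #|T| ^ 6)%N.
  by apply: leq_trans (max_card _) _; rewrite !card_prod; lia.
move: (#|T| ^ 2)%N (#|T| ^ 4)%N (#|T| ^ 6)%N star triv => x2 x4 x6 star triv.
have [z1|n1] := boolP (qzero f q1); have [z2|n2] := boolP (qzero f q2);
  have [z3|n3] := boolP (qzero f q3); rewrite /=;
  try by (apply: leq_trans triv _; rewrite ?muln1 ?muln0; lia).
- have := star q3 q1 q2 c3 c1 c2 n3 n2.
  by rewrite (card_linked_triangle_rot f q3 q1 q2) => /leq_trans; apply; lia.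
- by apply: leq_trans (star q1 q2 q3 c1 c2 c3 n1 n3) _; lia.
- have := star q2 q3 q1 c2 c3 c1 n2 n1.
  by rewrite -(card_linked_triangle_rot f q1 q2 q3) => /leq_trans; apply; lia.
- by apply: leq_trans (star q1 q2 q3 c1 c2 c3 n1 n3) _; lia.
Qed.

Lemma card_qdet_eq_le (R : realFieldType) (T : finType) (f : T -> R) (t : R) :
  (#|[set q | qdet f q == t]| <= mul_energy f)%N.
Proof.
have := card_shifted_collisions_le (fun p : T * T => f p.1 * f p.2) t.
apply: leq_trans; apply: subset_leq_card; apply/subsetP => q.
by rewrite !inE subr_eq addrC.
Qed.

Lemma card_qzero_le1 (R : realFieldType) (T : finType) (f : T -> R) :
  injective f -> (#|[set q | qzero f q]| <= 1)%N.
Proof.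
move=> f_inj; apply/card_le1P => -[[x y] [z w]]; rewrite inE.
move=> /and4P[/= /eqP h1 /eqP h2 /eqP h3 /eqP h4] [[x' y'] [z' w']].
have zE a b : f b = 0 -> (f a == 0) = (a == b) by move=> <-; rewrite (inj_eq f_inj).
rewrite !inE /qzero /= (zE x' x) // (zE y' y) // (zE z' z) // (zE w' w) //.
by rewrite !xpair_eqE !andbA.
Qed.

Lemma sum_prod3 (X : finType) (a b c : pred X) :
  (\sum_(t : X * (X * X)) [&& a t.1, b t.2.1 & c t.2.2] =
    #|[set x | a x]| * (#|[set x | b x]| * #|[set x | c x]|))%N.
Proof.
rewrite -!cardsX -card_set_sum; apply: eq_card => t.
by rewrite !inE.
Qed.

(** The right-hand sides may depend on the quadruples, as the bound for a triangle is uniform in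
    them. Summing it gives [|T|^6 E^2], [|T|^4 E^3] and three times [|T|^6 E], each at most
    [|T|^4 E^3] since [|T|^2 <= E]. *)
Lemma card_linked_le (R : realFieldType) (T : finType) (f : T -> R)
    (c1 c2 c3 : (T * T) * (T * T) ->
       (T * T) * (T * T) -> (T * T) * (T * T) -> R * R) :
  injective f -> (0 < #|T|)%N ->
  (\sum_(q : ((T * T) * (T * T)) * (((T * T) * (T * T)) * ((T * T) * (T * T))) |
         (qdet f q.2.1 == qdet f q.1) && (qdet f q.2.2 == qdet f q.1))
     #|linked_triangle f q.1 q.2.1 q.2.2 (c1 q.1 q.2.1 q.2.2)
         (c2 q.1 q.2.1 q.2.2) (c3 q.1 q.2.1 q.2.2)| <=
   5 * #|T| ^ 4 * mul_energy f ^ 3)%N.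
Proof.
move=> f_inj T0; set E := mul_energy f.
have ET : (#|T| ^ 2 <= E)%N by apply: mul_energy_ge.
have E0 : (0 < E)%N by apply: leq_trans ET; rewrite expn_gt0 T0.
have Edet : (#|[set q | (qdet f q == 0)%R]| <= E)%N by apply: card_qdet_eq_le.
have Z1 := card_qzero_le1 f_inj.
set B := (X in (X <= _)%N).
have : (B <= #|T| ^ 2 * (#|T| ^ 4 * (E * E)) + #|T| ^ 4 * (E * (E * E))
    + #|T| ^ 6 * (1 * (1 * E)) + #|T| ^ 6 * (E * (1 * 1))
    + #|T| ^ 6 * (1 * (E * 1)))%N.
  rewrite /B.
  eapply leq_trans.
    apply: leq_sum => q /andP[/eqP h1 /eqP h2].
    exact: (card_linked_triangle_le _ _ _ f_inj h1 h2).
  rewrite !big_split /=; repeat apply: leq_add.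
  (* The first quadruple is free, with [|T|^4] choices; the other two lie in the fibre of [qdet]
     over its value. *)
  - rewrite sum_nat_const [leqLHS]mulnC leq_mul2l; apply/orP; right.
    rewrite -[leqLHS]cardsE.
    rewrite (card_set_pair (fun q (t : ((T * T) * (T * T)) * ((T * T) * (T * T))) =>
      (qdet f t.1 == qdet f q) && (qdet f t.2 == qdet f q))).
    have -> : (#|T| ^ 4 = #|{: (T * T) * (T * T)}|)%N by rewrite !card_prod; lia.
    rewrite -sum_nat_const; apply: leq_sum => q _.
    apply: leq_trans (leq_mul (card_qdet_eq_le f (qdet f q))
      (card_qdet_eq_le f (qdet f q))).
    by rewrite -cardsX; apply: subset_leq_card; apply/subsetP => t; rewrite !inE.
  - rewrite -big_distrr /= leq_mul //; apply: leq_trans (leq_mul Edet (leq_mul Edet Edet)).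
    by rewrite -sum_prod3 [leqLHS]big_mkcond /=; apply: leq_sum => q _; case: ifP.
  - rewrite -big_distrr /= leq_mul //; apply: leq_trans (leq_mul Z1 (leq_mul Z1 Edet)).
    by rewrite -sum_prod3 [leqLHS]big_mkcond /=; apply: leq_sum => q _; case: ifP.
  - rewrite -big_distrr /= leq_mul //; apply: leq_trans (leq_mul Edet (leq_mul Z1 Z1)).
    rewrite -sum_prod3 [leqLHS]big_mkcond /=; apply: leq_sum => q _; case: ifP => // _.
    by rewrite andbA andbC.
  - rewrite -big_distrr /= leq_mul //; apply: leq_trans (leq_mul Z1 (leq_mul Edet Z1)).
    rewrite -sum_prod3 [leqLHS]big_mkcond /=; apply: leq_sum => q _; case: ifP => // _.
    by rewrite andbC -andbA.
have -> : (#|T| ^ 6 = #|T| ^ 4 * #|T| ^ 2)%N by rewrite -expnD.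
move: (#|T| ^ 4)%N (#|T| ^ 2)%N ET => x y yE.
have h1 : (y * (x * (E * E)) <= x * (E * (E * E)))%N.
  by rewrite mulnCA leq_mul2l leq_mul ?orbT.
have h2 : (x * y * E <= x * (E * (E * E)))%N.
  by rewrite -mulnA leq_mul2l leq_mul ?orbT // leq_pmulr.
rewrite !mul1n !muln1; move/leq_trans; apply.
by rewrite -mulnA (_ : E ^ 3 = E * (E * E))%N //; lia.
Qed.

(** * Commuting pairs of 3x3 matrices *)

Local Notation o0 := (@Ordinal 3 0 isT).
Local Notation o1 := (@Ordinal 3 1 isT).
Local Notation o2 := (@Ordinal 3 2 isT).

Lemma ord3P (P : 'I_3 -> Prop) : P o0 -> P o1 -> P o2 -> forall i, P i.
Proof.
move=> h0 h1 h2 [[|[|[|//]]] hi].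
- by rewrite (bool_irrelevance hi isT).
- by rewrite (bool_irrelevance hi isT).
- by rewrite (bool_irrelevance hi isT).
Qed.

Lemma sum_ord3 (V : zmodType) (F : 'I_3 -> V) :
  \sum_i F i = F o0 + F o1 + F o2.
Proof.
rewrite !big_ord_recl big_ord0 addr0 addrA.
by congr (_ + _ + _); congr F; apply: val_inj.
Qed.

Definition mx3 (T : Type) (x00 x01 x02 x10 x11 x12 x20 x21 x22 : T) : 'M[T]_3 :=
  \matrix_(i, j) nth x00 (nth [::] [:: [:: x00; x01; x02]; [:: x10; x11; x12];
    [:: x20; x21; x22]] i) j.

(** The index pairs [01], [12], [20] are taken cyclically, to match the edges of
    [linked_triangle]. *)
Definition entries (T : finType) (p : 'M[T]_3 * 'M[T]_3) :=
  let q i j := ((p.1 i j, p.2 j i), (p.1 j i, p.2 i j)) in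
  let e i := (p.1 i i, p.2 i i) in
  ((q o0 o1, (q o1 o2, q o2 o0)), (e o0, (e o1, e o2))).

Lemma entries_inj (T : finType) : injective (@entries T).
Proof.
move=> [M N] [M' N'] [] *; congr pair; apply/matrixP.
  by apply: ord3P; apply: ord3P.
by apply: ord3P; apply: ord3P.
Qed.

(* If [q], [q'], [q''] hold the entries of index [ij], [jk], [ki], these are the
   right-hand sides of the equations that [A B = B A] imposes on
   [(a_ii - a_jj, b_ii - b_jj)]. *)
Definition link_rhs (R : realFieldType) (T : finType) (f : T -> R)
    (q' q'' : (T * T) * (T * T)) : R * R :=
  (f q''.1.2 * f q'.2.1 - f q''.2.1 * f q'.1.2,
   f q'.1.1 * f q''.2.2 - f q'.2.2 * f q''.1.1).

(** Two diagonal entries of [AB = BA] equate the determinants; the six off-diagonal ones are the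
    links. *)
Lemma entries_commuting (R : realFieldType) (T : finType) (f : T -> R)
    (p : 'M[T]_3 * 'M[T]_3) :
  map_mx f p.1 *m map_mx f p.2 = map_mx f p.2 *m map_mx f p.1 ->
  let q := (entries p).1 in
  [/\ qdet f q.2.1 = qdet f q.1, qdet f q.2.2 = qdet f q.1 &
    (entries p).2 \in linked_triangle f q.1 q.2.1 q.2.2
      (link_rhs f q.2.1 q.2.2) (link_rhs f q.2.2 q.1) (link_rhs f q.1 q.2.1)].
Proof.
move=> /matrixP ab.
have {}ab i j : f (p.1 i o0) * f (p.2 o0 j) + f (p.1 i o1) * f (p.2 o1 j)
      + f (p.1 i o2) * f (p.2 o2 j) =
    f (p.2 i o0) * f (p.1 o0 j) + f (p.2 i o1) * f (p.1 o1 j)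
      + f (p.2 i o2) * f (p.1 o2 j).
  by have := ab i j; rewrite !mxE !sum_ord3 !mxE.
rewrite /qdet inE /link /link_rhs /entries /=; split.
- by have := ab o1 o1; lra.
- by have := ab o0 o0; lra.
- apply/and3P; split; apply/andP; split; apply/eqP.
  + by have := ab o0 o1; lra.
  + by have := ab o1 o0; lra.
  + by have := ab o1 o2; lra.
  + by have := ab o2 o1; lra.
  + by have := ab o2 o0; lra.
  + by have := ab o0 o2; lra.
Qed.

Definition commuting_pairs (R : realFieldType) (T : finType) (f : T -> R) :
    {set 'M[T]_3 * 'M[T]_3} :=
  [set p | map_mx f p.1 *m map_mx f p.2 == map_mx f p.2 *m map_mx f p.1].

Lemma card_commuting_pairs_le (R : realFieldType) (T : finType) (f : T -> R) :
  injective f -> (0 < #|T|)%N ->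
  (#|commuting_pairs f| <= 5 * #|T| ^ 4 * mul_energy f ^ 3)%N.
Proof.
move=> f_inj T0; rewrite -(card_imset _ (@entries_inj T)).
apply: leq_trans (card_linked_le (fun _ q2 q3 => link_rhs f q2 q3)
  (fun q1 _ q3 => link_rhs f q3 q1) (fun q1 q2 _ => link_rhs f q1 q2) f_inj T0).
pose tri (q : ((T * T) * (T * T)) * (((T * T) * (T * T)) * ((T * T) * (T * T)))) :=
  linked_triangle f q.1 q.2.1 q.2.2 (link_rhs f q.2.1 q.2.2)
    (link_rhs f q.2.2 q.1) (link_rhs f q.1 q.2.1).
pose D (q : ((T * T) * (T * T)) * (((T * T) * (T * T)) * ((T * T) * (T * T)))) :=
  (qdet f q.2.1 == qdet f q.1) && (qdet f q.2.2 == qdet f q.1).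
(* The count is fibred over the off-diagonal quadruples with equal determinants, each carrying its
   triangle of diagonals. *)
apply: (@leq_trans #|[set z | D z.1 && (z.2 \in tri z.1)]|).
  apply: subset_leq_card; apply/subsetP => _ /imsetP[p + ->].
  rewrite in_set => /eqP/entries_commuting[/eqP h1 /eqP h2 h3].
  by rewrite in_set /D h1 h2; exact: h3.
rewrite (card_set_pair (fun q e => D q && (e \in tri q))) [leqRHS]big_mkcond /=.
apply: leq_sum => q _; rewrite -/(D q); case: (D q) => /=.
  by rewrite -/(tri q); apply: subset_leq_card; apply/subsetP => e; rewrite inE.
by rewrite leqn0 cards_eq0; apply/eqP/setP => e; rewrite !inE.
Qed.

(** Both matrices share their off-diagonal entries, so under [f] they differ by a scalar matrix once
    the three diagonal differences agree. *)
Definition scalar_shift (T : finType)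
    (z : ((T * T) * ((T * T) * (T * T))) * ((T * T) * ((T * T) * (T * T)))) :
    'M[T]_3 * 'M[T]_3 :=
  let: ((x01, x10), ((x12, x21), (x20, x02)), ((a0, b0), ((a1, b1), (a2, b2)))) := z in
  (mx3 a0 x01 x02 x10 a1 x12 x20 x21 a2, mx3 b0 x01 x02 x10 b1 x12 x20 x21 b2).

Lemma scalar_shift_inj (T : finType) : injective (@scalar_shift T).
Proof.
move=> [[[? ?] [[? ?] [? ?]]] [[? ?] [[? ?] [? ?]]]].
move=> [[[? ?] [[? ?] [? ?]]] [[? ?] [[? ?] [? ?]]]] /(congr1 (@entries T)).
by rewrite /entries /scalar_shift /= !mxE /=; case=> *; subst.
Qed.

(* Here [B = A - lambda I]. *)
Lemma card_commuting_pairs_ge (R : realFieldType) (T : finType) (f : T -> R)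
    (S : seq R) : uniq S -> (forall x y, f x + f y \in S) ->
  (#|T| ^ 12 <= size S ^ 2 * #|commuting_pairs f|)%N.
Proof.
move=> uS fS; have := card_equal_differences_ge uS fS.
set Eq3 := [set e | _] => le_Eq.
have : (#|T| ^ 6 * #|Eq3| <= #|commuting_pairs f|)%N.
  have -> : (#|T| ^ 6 = #|[set: (T * T) * ((T * T) * (T * T))]|)%N.
    by rewrite cardsT !card_prod; lia.
  rewrite -cardsX -(card_imset _ (@scalar_shift_inj T)).
  apply: subset_leq_card; apply/subsetP => _ /imsetP[z + ->].
  case: z => [[[x01 x10] [[x12 x21] [x20 x02]]] [[a0 b0] [[a1 b1] [a2 b2]]]].
  rewrite !inE /= => /andP[/eqP e1 /eqP e2].
  set A := map_mx f _; set B := map_mx f _.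
  have -> : B = A - (f a0 - f b0)%:M.
    apply/matrixP; apply: ord3P; apply: ord3P; rewrite !mxE /=; lra.
  by rewrite mulmxBl mulmxBr scalar_mxC.
move=> le_C; have -> : (#|T| ^ 12 = #|T| ^ 6 * #|T| ^ 6)%N by rewrite -expnD.
apply: leq_trans (leq_mul (leqnn _) le_Eq) _.
by rewrite mulnCA leq_mul2l le_C orbT.
Qed.

(** * Both bounds in terms of [K] and the logarithm *)

Theorem theorem1p6 (R : realType) :
  exists c1 c2 : R, 0 < c1 /\ 0 < c2 /\
  forall A : seq R, uniq A -> A != [::] ->
    let n : R := (size A)%:R in
    let K : R := (sumset_card A)%:R / n in
    c1 * K ^- 3 * n ^+ 10 <= (C3 A)%:R /\
    (C3 A)%:R <= c2 * K ^+ 6 * n ^+ 10 * (ln (2 * n)) ^+ 3.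
Proof.
have l2 : 0 < ln 2 :> R by rewrite ln_gt0 // ltr1n.
(* The 5 comes from [card_linked_le], the 68 from the energy bound, and [1 / ln 2] from comparing
   harmonic sums with the logarithm. *)
exists 1, (5 * (68 * (ln 2)^-1) ^+ 3); split=> //; split.
  by rewrite mulr_gt0 ?exprn_gt0 ?mulr_gt0 ?invr_gt0.
move=> A uA A0 n K.
pose f (i : 'I_(size A)) := nth 0 A i.
have f_inj : injective f.
  by move=> i j /eqP; rewrite /f nth_uniq // => /eqP/val_inj.
pose S := undup [seq a + b | a <- A, b <- A].
have uS : uniq S by apply: undup_uniq.
have fS x y : f x + f y \in S.
  by rewrite mem_undup; apply: allpairs_f; rewrite mem_nth.
have nA : (0 < size A)%N by rewrite lt0n size_eq0.
have n0 : 0 < n by rewrite ltr0n.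
have T0 : (0 < #|'I_(size A)|)%N by rewrite card_ord.
have lower := card_commuting_pairs_ge uS fS.
have upper := card_commuting_pairs_le f_inj T0.
have energy := mul_energy_le f_inj fS T0.
have le_nS := card_sums_ge f_inj fS.
have harm := harmonic_sum_le_ln R T0.
rewrite card_ord in lower upper energy le_nS harm.
have C3E : C3 A = #|commuting_pairs f| by [].
pose s : R := (size S)%:R.
have KE : K = s / n by [].
have s0 : 0 < s by rewrite ltr0n (leq_trans nA).
have ns : n <= s by rewrite ler_nat.
rewrite C3E; split.
  have {}lower : n ^+ 12 <= s ^+ 2 * (#|commuting_pairs f|)%:R.
    by rewrite -!natrX -natrM ler_nat.
  (* The count supplies [n^12 <= s^2 C], where [C] is the number of commuting pairs; the remaining
     factor is [n <= s]. *)
  have -> : 1 * K ^- 3 * n ^+ 10 = (n ^+ 12 * n) / (s ^+ 2 * s).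
    by rewrite KE; field; rewrite !gt_eqF.
  rewrite ler_pdivrMr ?mulr_gt0 ?exprn_gt0 // mulrA [_%:R * _]mulrC.
  by apply: ler_pM => //; rewrite ?exprn_ge0 ?ltW.
have {}energy : (mul_energy f)%:R <= 68 * (ln 2)^-1 * s ^+ 2 * ln (2 * n).
  apply: le_trans energy _.
  rewrite (_ : 68 * _ * _ * _ = 68 * s ^+ 2 * ((ln 2)^-1 * ln (2 * n))); last by ring.
  by rewrite ler_pM2l // mulr_gt0 // exprn_gt0.
apply: (@le_trans _ _ (5 * n ^+ 4 * (mul_energy f)%:R ^+ 3)).
  by rewrite -!natrX -!natrM ler_nat.
(* As [s = K n], the product [n^4 s^6] is [K^6 n^10]. *)
have -> : 5 * (68 / ln 2) ^+ 3 * K ^+ 6 * n ^+ 10 * ln (2 * n) ^+ 3 =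
    5 * n ^+ 4 * (68 * (ln 2)^-1 * s ^+ 2 * ln (2 * n)) ^+ 3.
  by rewrite KE; field; rewrite !gt_eqF.
rewrite ler_pM2l ?mulr_gt0 ?exprn_gt0 // lerXn2r // nnegrE ?ler0n //.
exact: le_trans (ler0n _ _) energy.
Qed.
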